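(* Let $\tau_1\in\mathcal{L}_0^*$ and $\tau_2\in\mathcal{L}_0$ with $\tau_1\subsetneq\tau_2$. Then there exist a chain $\mathcal{R}\subset\mathcal{L}_0$ with $|\mathcal{R}|=\mathfrak{c}$, a family $\mathcal{S}\subset\mathcal{L}_0$ of pairwise incomparable topologies with $|\mathcal{S}|=\mathfrak{c}$, and a family $\mathcal{T}\subset\mathcal{L}_0\setminus\mathcal{L}_0^*$ of pairwise incomparable topologies with $|\mathcal{T}|=2^{\mathfrak{c}}$, such that $\tau_1\subset\tau\subset\tau_2$ for every $\tau\in\mathcal{R}\cup\mathcal{S}\cup\mathcal{T}$. Moreover, if $\tau_2\in\mathcal{L}_0^*$ then $\mathcal{R},\mathcal{S}$ can be chosen with $\mathcal{R},\mathcal{S}\subset\mathcal{L}_0^*$; and if $\tau_2=\eta$ then $\mathcal{R},\mathcal{S}$ can be chosen with $\mathcal{R},\mathcal{S}\subset\mathcal{L}_0^*$ and such that all spaces $(\mathbb{R},\tau)$ with $\tau\in\mathcal{R}\cup\mathcal{S}$ are pairwise homeomorphic.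
   Context: $\mathfrak{c}=|\mathbb{R}|$. $\eta$ denotes the Euclidean topology on $\mathbb{R}$. $\mathcal{L}$ denotes the family of all Hausdorff topologies $\tau$ on $\mathbb{R}$ with $\tau\subset\eta$. For $\tau\in\mathcal{L}$ and $a\in\mathbb{R}$ let $\mathcal{N}_\tau(a)$ be the neighborhood filter of $a$ in $(\mathbb{R},\tau)$; let $C(\tau)$ be the set of all $a$ with $\mathcal{N}_\tau(a)\neq\mathcal{N}_\eta(a)$. $\mathcal{L}_0:=\{\tau\in\mathcal{L}\mid C(\tau)\subset\{0\}\}$. $\mathcal{L}_0^*$ denotes the family of all $\tau\in\mathcal{L}_0$ such that $\mathcal{N}_\tau(0)=\mathcal{N}_\eta(0)\cap\mathcal{F}$ for some filter $\mathcal{F}$ on $\mathbb{R}$ generated by a countable filter base. A chain is a family of topologies totally ordered by inclusion; two topologies are incomparable if neither is a subset of the other. *)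

(* Defs.v *)
From HB Require Import structures.
From mathcomp Require Import all_boot all_order all_algebra.
From mathcomp Require Import boolp classical_sets cardinality.
From mathcomp Require Import reals Rstruct Rstruct_topology topology normedtype.
From Stdlib Require Import Reals.

Set Implicit Arguments. Unset Strict Implicit. Unset Printing Implicit Defensive.
Local Open Scope classical_set_scope.

Notation RR := Rdefinitions.R.

Definition eta : set (set RR) := [set U | open U].

Definition is_topology (t : set (set RR)) : Prop :=
  t set0 /\ t setT /\
  (forall F : set (set RR), F `<=` t -> t (\bigcup_(A in F) A)) /\
  (forall U V, t U -> t V -> t (U `&` V)).

Definition hausdorff (t : set (set RR)) : Prop :=
  forall x y : RR, x <> y ->
    exists U V, t U /\ t V /\ U x /\ V y /\ U `&` V = set0.

Definition L (t : set (set RR)) : Prop :=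
  is_topology t /\ hausdorff t /\ t `<=` eta.

Definition nbhd_filter (t : set (set RR)) (a : RR) : set (set RR) :=
  [set N | exists U, t U /\ U a /\ U `<=` N].

Definition Cset (t : set (set RR)) : set RR :=
  [set a | nbhd_filter t a <> nbhd_filter eta a].

Definition L0 (t : set (set RR)) : Prop :=
  L t /\ Cset t `<=` [set (0:RR)].

Definition gen_filter (B : nat -> set RR) : set (set RR) :=
  [set N | exists n, B n `<=` N].

Definition countable_filter_base (B : nat -> set RR) : Prop :=
  (forall n, B n !=set0) /\
  (forall n m, exists k, B k `<=` B n `&` B m).

Definition L0star (t : set (set RR)) : Prop :=
  L0 t /\ exists B : nat -> set RR, countable_filter_base B /\
    nbhd_filter t 0 = nbhd_filter eta 0 `&` gen_filter B.

Definition is_chain (F : set (set (set RR))) : Prop :=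
  forall a b, F a -> F b -> a `<=` b \/ b `<=` a.

Definition pairwise_incomparable (F : set (set (set RR))) : Prop :=
  forall a b, F a -> F b -> a <> b -> ~ (a `<=` b) /\ ~ (b `<=` a).

Definition homeomorphic (t t' : set (set RR)) : Prop :=
  exists f g : RR -> RR, cancel f g /\ cancel g f /\
    (forall U, t' U -> t (f @^-1` U)) /\ (forall U, t U -> t' (g @^-1` U)).

(* Main.v *)
(**
A topology in L0 is determined by its neighborhood filter at 0. Choose an open W
in t2 but not in t1, with 0 in W. Since t1 is Hausdorff, the t1-neighborhoods of
0 meet the complement of W outside every bounded set; as the filter F attached to
t1 has a countable base, this yields points x_k outside W tending to infinity,
with disjoint open intervals I_k around x_k such that every t1-neighborhood of 0
contains almost all I_k. For a filter G of subsets of nat finer than the cofinite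
one, the sets U in t2 such that [{k | I_k `<=` U}] is in G whenever 0 is in U form
a topology between t1 and t2, and this topology is strictly monotone in G. Chains
and antichains of filters on nat thus give R, S and T. For T one takes the filters
generated by the cofinite sets and, for each real r, by A_r or its complement,
where A is an independent family: they are pairwise incomparable, and not
countably generated because the reals are uncountable.

For the homeomorphisms, t2 is first replaced by the topology t3 of those U that,
if they contain 0, contain almost all right halves J_k of I_k. The topologies in R
and S are then given by intervals which are I_k for k in A and J_k otherwise, and
any two such sequences of intervals are exchanged by a piecewise linear
homeomorphism of the line.
*)
Require Import Defs.
From mathcomp Require Import all_boot all_order all_algebra.
From mathcomp Require Import boolp classical_sets functions cardinality filter.
From mathcomp Require Import reals Rstruct Rstruct_topology topology normedtype.
From mathcomp Require Import ring lra.
From Stdlib Require Import Runcountable.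
Import Order.TTheory GRing.Theory Num.Theory numFieldNormedType.Exports.
Local Open Scope classical_set_scope.
Local Open Scope ring_scope.

(** * Families of sets of natural numbers *)

(** Since every element keeps recurring, a single witness in [T] yields witnesses [k] beyond every
    bound, as comparisons modulo finite sets demand. *)
Lemma enum_infinitely_often (T : countType) :
  exists d : nat -> option T,
    forall x n, exists2 k, (n <= k)%N & d k = Some x.
Proof.
(* The 2-adic valuation takes each value infinitely often; the odd factor [n.*2.+1] below pushes [k]
   past [n] without changing it. *)
exists (fun k => unpickle (logn 2 k)) => x n.
exists (2 ^ pickle x * n.*2.+1)%N.
  apply: (@leq_trans n.*2.+1); first by rewrite -addnn leqW // leq_addr.
  by rewrite leq_pmull // expn_gt0.
rewrite lognM ?expn_gt0 // pfactorK // [logn 2 n.*2.+1]lognE /= dvdn2 /=.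
by rewrite odd_double /= addn0 pickleK.
Qed.

(** [D r] consists of the codes of the rationals below [r]; a rational between [r] and [s] has
    arbitrarily large codes. *)
Lemma chain_family : exists D : RR -> set nat,
  (forall r s : RR, r <= s -> D r `<=` D s) /\
  (forall (r s : RR) n, r < s ->
     exists k, [/\ (n <= k)%N, D s k & ~ D r k]).
Proof.
have [d dP] := enum_infinitely_often rat.
exists (fun r => [set k | exists2 q, d k = Some q & ratr q < r]).
split=> [r s rs k [q dk qr]|r s n rs].
  by exists q => //; exact: lt_le_trans rs.
have [q] := rat_in_itvoo rs; rewrite in_itv /= => /andP[rq qs].
have [k nk dk] := dP q n; exists k; split=> //; first by exists q.
by move=> [q']; rewrite dk => -[<-] /(lt_trans rq); rewrite ltxx.
Qed.

(** Finite unions of rational intervals are countable in number, yet separate disjoint finite sets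
    of reals. *)
Definition rat_cover (r : RR) (l : seq (rat * rat)) :=
  has (fun I => (ratr I.1 < r) && (r < ratr I.2)) l.

Lemma rat_interval_avoid (r : RR) (s : seq RR) : r \notin s ->
  exists I : rat * rat, rat_cover r [:: I] /\
    forall x, x \in s -> ~~ rat_cover x [:: I].
Proof.
elim: s => [_|x s IHs].
  have r1 : r - 1 < r by lra.
  have r2 : r < r + 1 by lra.
  have [a] := rat_in_itvoo r1; have [b] := rat_in_itvoo r2.
  rewrite !in_itv /= => /andP[rb _] /andP[_ ar].
  by exists (a, b); rewrite /rat_cover /= ar rb.
rewrite inE negb_or => /andP[rx /IHs[[a b]]].
rewrite /rat_cover /= orbF => -[/andP[ar rb] sP].
(* Shrinking keeps out the points already avoided, so only [x] has to be checked. *)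
have sub (a' b' : rat) : a <= a' -> b' <= b -> ratr a' < r -> r < ratr b' ->
    ~~ ((ratr a' < x) && (x < ratr b')) ->
    exists I : rat * rat, rat_cover r [:: I] /\
      forall y, y \in x :: s -> ~~ rat_cover y [:: I].
  move=> aa bb ar' rb' xP; exists (a', b'); rewrite /rat_cover /= ar' rb'.
  split=> // y; rewrite orbF inE => /orP[/eqP -> //|/sP]; rewrite orbF.
  apply: contra => /andP[h1 h2]; rewrite (le_lt_trans _ h1) ?ler_rat //.
  by rewrite (lt_le_trans h2) ?ler_rat.
have [rx'|xr|rxE] := ltgtP r x; last by rewrite rxE eqxx in rx.
- have [c] := rat_in_itvoo rx'; rewrite in_itv /= => /andP[rc cx].
  (* If [c] lies beyond [b], the old interval already stops short of [x]. *)
  have [cb|bc] := leP c b; first by apply: (sub a c) => //; rewrite (lt_gtF cx) andbF.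
  apply: (sub a b) => //; rewrite negb_and -!leNgt; apply/orP; right.
  by rewrite ltW// (lt_trans _ cx)// ltr_rat.
- have [c] := rat_in_itvoo xr; rewrite in_itv /= => /andP[xc cr].
  have [ac|ca] := leP a c; first by apply: (sub c b) => //; rewrite (lt_gtF xc).
  apply: (sub a b) => //; rewrite negb_and -!leNgt; apply/orP; left.
  by rewrite ltW// (lt_trans xc)// ltr_rat.
Qed.

Definition independent (A : RR -> set nat) :=
  forall (p q : seq RR), (forall r, r \in p -> r \notin q) ->
  forall n, exists k, [/\ (n <= k)%N, forall r, r \in p -> A r k &
                          forall r, r \in q -> ~ A r k].

(** [A r] collects the codes of the finite unions of rational intervals that contain [r]. *)
Lemma independent_family : exists A : RR -> set nat, independent A.
Proof.
have [d dP] := enum_infinitely_often (seq (rat * rat)).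
exists (fun r => [set k | exists2 l, d k = Some l & rat_cover r l]) => p q pq n.
have [l [lp lq]] : exists l, (forall r, r \in p -> rat_cover r l) /\
    (forall r, r \in q -> ~~ rat_cover r l).
  elim: p pq => [_|x p IHp pq]; first by exists [::].
  have [r rp|l [lp lq]] := IHp; first by apply: pq; rewrite inE rp orbT.
  have [I [xI Iq]] := @rat_interval_avoid x q (pq x (mem_head _ _)).
  exists (I :: l); rewrite /rat_cover /= in xI *; split=> r.
    rewrite inE => /orP[/eqP->|/lp]; last by rewrite /rat_cover => ->; rewrite orbT.
    by move: xI; rewrite orbF => ->.
  move=> rq; move: (Iq r rq) (lq r rq); rewrite /rat_cover /= orbF.
  by move=> /negbTE -> /negbTE ->.
have [k nk dk] := dP l n; exists k; split=> // r.
  by move=> /lp lr; exists l.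
by move=> /lq lr [l']; rewrite dk => -[<-]; exact/negP.
Qed.

Lemma R_not_countable : ~ countable [set: RR].
Proof.
move=> cR; have infR : infinite_set [set: RR].
  apply/infiniteP/(@card_le_trans _ _ _ (range (fun n => n%:R : RR)));
    last exact: card_leT.
  have : (range (fun n => n%:R : RR) #= [set: nat])%card.
    by apply: inj_card_eq => m n _ _ /eqP; rewrite eqr_nat => /eqP.
  by rewrite card_eq_le => /andP[].
have /card_set_bijP[f] : ([set: nat] #= [set: RR])%card.
  by rewrite card_eq_sym; exact: eq_card_nat.
rewrite setTT_bijective => -[g fK gK].
by apply: (@R_uncountable f); exists g.
Qed.

(** * Filters generated by literals of an independent family *)

(** The filter generated by the cofinite sets, the [A r] with [r] in [S] and the complements of the
    other [A r]; [p] and [q] list the finitely many generators used. *)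
Definition literal_filter (A : RR -> set nat) (S : set RR) : set_system nat :=
  [set B | exists p q : seq RR,
     [/\ forall r, r \in p -> S r, forall r, r \in q -> ~ S r &
         \forall k \near \oo, (forall r, r \in p -> A r k) ->
           (forall r, r \in q -> ~ A r k) -> B k]].

Lemma literal_filter_filter A S : Filter (literal_filter A S).
Proof.
split.
- by exists [::], [::]; split=> //; near=> k.
- move=> B C [p [q [pS qS BP]]] [p' [q' [pS' qS' CP]]].
  exists (p ++ p'), (q ++ q'); split=> [r|r|].
  + by rewrite mem_cat => /orP[/pS|/pS'].
  + by rewrite mem_cat => /orP[/qS|/qS'].
  near=> k => pk qk; split.
    by apply: (near BP k) => // r rx; [apply: pk|apply: qk]; rewrite mem_cat rx.
  by apply: (near CP k) => // r rx; [apply: pk|apply: qk]; rewrite mem_cat rx orbT.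
- move=> B C BC [p [q [pS qS BP]]]; exists p, q; split=> //.
  by near=> k => pk qk; apply: BC; apply: (near BP k).
Unshelve. all: by end_near. Qed.

Lemma eventually_literal_filter A S : \oo `<=` literal_filter A S.
Proof.
move=> B oB; exists [::], [::]; split=> //.
by near=> k => _ _; apply: (near oB k).
Unshelve. all: by end_near. Qed.

Lemma literal_filter_pos A (S : set RR) r : S r -> literal_filter A S (A r).
Proof.
move=> Sr; exists [:: r], [::]; split=> // [x|]; first by rewrite inE => /eqP->.
by near=> k => pk _; apply: pk; rewrite inE.
Unshelve. all: by end_near. Qed.

Lemma literal_filter_neg A (S : set RR) r : ~ S r -> literal_filter A S (~` A r).
Proof.
move=> Sr; exists [::], [:: r]; split=> // [x|]; first by rewrite inE => /eqP->.
by near=> k => _ qk; apply: qk; rewrite inE.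
Unshelve. all: by end_near. Qed.

Lemma literal_filter_proper A S : independent A -> ~ literal_filter A S set0.
Proof.
move=> Aind [p [q [pS qS [n _ nP]]]].
have [|k [nk pk qk]] := Aind p q _ n.
  by move=> r /pS Sr; apply/negP => /qS.
exact: (nP k nk pk qk).
Qed.

(** If [S] and [S'] differ at [r], the larger filter contains both [A r] and its complement, against
    properness. *)
Lemma literal_filter_inj A S S' : independent A ->
  literal_filter A S `<=` literal_filter A S' -> S = S'.
Proof.
move=> Aind GG; have FF := literal_filter_filter A S'.
apply/seteqP; split=> r Sr; apply: contrapT => S'r;
  apply: (@literal_filter_proper A S' Aind).
  rewrite -(setICr (A r)); apply: filterI; last exact: literal_filter_neg.
  exact/GG/literal_filter_pos.
rewrite -(setICr (A r)); apply: filterI; first exact: literal_filter_pos.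
exact/GG/literal_filter_neg.
Qed.

Definition countably_generated (G : set_system nat) :=
  exists E : nat -> set nat, (forall m, G (E m)) /\
    forall B, G B -> exists m, E m `<=` B.

(** Countably many generators use countably many literals, so some real [r] occurs in none of them,
    and independence leaves [A r] undecided by each [E m]. *)
Lemma literal_filter_not_countably_generated A S : independent A ->
  ~ countably_generated (literal_filter A S).
Proof.
move=> Aind [E [EG Egen]].
have [p pP] := choice EG; have [q qP] := choice pP.
have [r rP] : exists r, forall m, r \notin p m ++ q m.
  apply: contrapT => /forallNP H; apply: R_not_countable.
  rewrite (_ : setT = \bigcup_m [set` p m ++ q m]).
    by apply: bigcup_countable => // m _; exact: finite_set_countable.
  apply/seteqP; split=> // x _; have /existsNP[m /negP] := H x.
  by rewrite negbK => xm; exists m.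
have pr m : r \notin p m by have := rP m; rewrite mem_cat negb_or => /andP[].
have qr m : r \notin q m by have := rP m; rewrite mem_cat negb_or => /andP[].
have pq m x : x \in p m -> x \notin q m.
  by have [pS qS _] := qP m; move=> /pS Sx; apply/negP => /qS.
(* Whichever of [A r] and its complement is in the filter, the opposite literal can be added to
   those of [E m]. *)
have [Sr|Sr] := pselect (S r).
- have [m Em] := Egen _ (literal_filter_pos A S r Sr).
  have [_ _ [n _ nP]] := qP m.
  have [|k [nk pk qk]] := Aind (p m) (r :: q m) _ n.
    move=> x xp; rewrite inE negb_or pq // andbT.
    by apply: contraNneq (pr m) => <-.
  apply: (qk r (mem_head _ _)); apply: Em; apply: nP => // x xq.
  by apply: qk; rewrite inE xq orbT.
- have [m Em] := Egen _ (literal_filter_neg A S r Sr).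
  have [_ _ [n _ nP]] := qP m.
  have [|k [nk pk qk]] := Aind (r :: p m) (q m) _ n.
    by move=> x; rewrite inE => /orP[/eqP->|/pq].
  have : (~` A r) k by apply: Em; apply: nP => // x xp; apply: pk; rewrite inE xp orbT.
  by apply; apply: pk; rewrite inE eqxx.
Qed.

(** * Topologies coarsened at the origin *)

(* The [0] of the definition is [IZR 0], only convertible to the zero of the
   ring [RR]. *)
Lemma L0starE t : L0star t = (L0 t /\ exists B : nat -> set RR,
  countable_filter_base B /\
  nbhd_filter t (0%R : RR) = nbhd_filter eta (0%R : RR) `&` gen_filter B).
Proof. by []. Qed.

Lemma nbhd_filter_sub t t' a : t `<=` t' -> nbhd_filter t a `<=` nbhd_filter t' a.
Proof. by move=> tt' N [U [/tt' tU UN]]; exists U. Qed.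

Lemma topology_nbhdP t U : is_topology t ->
  (forall a, U a -> nbhd_filter t a U) -> t U.
Proof.
move=> [_ [_ [tbig _]]] tU.
rewrite (_ : U = \bigcup_(V in [set V | t V /\ V `<=` U]) V).
  by apply: tbig => V [].
apply/seteqP; split=> [a Ua|a [V [_ VU] /VU //]].
by have [V [tV [Va VU]]] := tU a Ua; exists V.
Qed.

Lemma topologyU t U V : is_topology t -> t U -> t V -> t (U `|` V).
Proof.
move=> [_ [_ [tbig _]]] tU tV.
rewrite (_ : U `|` V = \bigcup_(S in [set U; V]) S).
  by apply: tbig => S [->|->].
by rewrite bigcup_setU !bigcup_set1.
Qed.

Lemma L0_nbhd t a : L0 t -> a <> 0 -> nbhd_filter t a = nbhd_filter eta a.
Proof. by move=> [_ C0] a0; apply: contrapT => /C0. Qed.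

(** Away from 0 the neighborhoods are Euclidean, so only 0 needs checking. *)
Lemma L0_openP t (U : set RR) : L0 t -> open U -> (U 0 -> nbhd_filter t 0 U) -> t U.
Proof.
move=> Lt oU U0; have [[topt _] _] := Lt.
apply: topology_nbhdP => // a Ua; have [a0|/eqP a0] := eqVneq a 0.
  by rewrite a0 in Ua *; exact: U0.
rewrite (L0_nbhd _ _ Lt a0); exists U; split; [exact: oU|by split].
Qed.

Lemma L0_between t1 t : L0 t1 -> is_topology t -> t1 `<=` t -> t `<=` eta -> L0 t.
Proof.
move=> Lt1 topt t1t te; have [[_ [haus _]] _] := Lt1.
split.
  split=> //; split=> // x y /haus[U [V [tU [tV UV]]]].
  by exists U, V; do 2!(split; first exact: t1t).
move=> a /= Ca; apply: contrapT => a0; apply: Ca; apply/seteqP; split.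
  exact: nbhd_filter_sub.
by rewrite -(L0_nbhd _ _ Lt1 a0); exact: nbhd_filter_sub.
Qed.

(** The coarsening of [t] that makes the sets [O k] converge to 0 along [G]; sets missing 0 are
    unaffected. *)
Definition coarsen (t : set (set RR)) (O : nat -> set RR) (G : set_system nat) :=
  [set U | t U /\ (U 0 -> G [set k | O k `<=` U])].

Lemma coarsen_topology t O G : Filter G -> is_topology t ->
  is_topology (coarsen t O G).
Proof.
move=> FG [t0 [tT [tbig tI]]]; split; first by split.
split; first by split=> // _; apply: filterS filterT => k.
split=> [F FG'|U V [tU UG] [tV VG]].
  split=> [|[U FU U0]]; first by apply: tbig => U /FG'[].
  apply: filterS ((FG' U FU).2 U0) => k OU y /OU Uy.
  by exists U.
split=> [|[/UG GU /VG GV]]; first exact: tI.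
apply: filterS2 GU GV => k OU OV y Oy.
by split; [exact: OU|exact: OV].
Qed.

Lemma coarsen_sub t O G : coarsen t O G `<=` t.
Proof. by move=> U []. Qed.

Lemma coarsenS t O G H : G `<=` H -> coarsen t O G `<=` coarsen t O H.
Proof. by move=> GH U [tU UG]; split=> // /UG/GH. Qed.

(* Since [x k] lies in [O k] only and not in [W], adding some of the sets [O k] to
   [W] keeps track of which ones were added. *)
Record probes (t : set (set RR)) (W : set RR) (O : nat -> set RR)
    (x : nat -> RR) : Prop := Probes {
  probesW : t W;
  probesW0 : W 0;
  probesO : forall k, open (O k);
  probesO0 : forall k, ~ O k 0;
  probes_mem : forall k, O k (x k);
  probes_notin : forall k, ~ W (x k);
  probes_inj : forall j k, O j (x k) -> j = k }.

Definition probe_set (W : set RR) (O : nat -> set RR) (A : set nat) :=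
  W `|` \bigcup_(k in A) O k.

Lemma open_bigcup_in t (O : nat -> set RR) A : L0 t -> (forall k, open (O k)) ->
  (forall k, ~ O k 0) -> t (\bigcup_(k in A) O k).
Proof.
move=> Lt oO O0; apply: L0_openP => // [|[k _ /O0 //]].
exact: bigcup_open.
Qed.

Section Probes.
Variables (t : set (set RR)) (W : set RR) (O : nat -> set RR) (x : nat -> RR).
Hypotheses (Lt : L0 t) (tP : probes t W O x).

Lemma probe_set_mem A k : probe_set W O A (x k) -> A k.
Proof.
move=> [/(probes_notin _ _ _ _ tP) //|[j Aj Oj]].
by rewrite -(probes_inj _ _ _ _ tP _ _ Oj).
Qed.

(** The points [x k] show that the probe set contains [O k] for [k] in [A] only, so [G] can be read
    off from the topology. *)
Lemma coarsen_probe_set G A : coarsen t O G (probe_set W O A) <-> G A.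
Proof.
have -> : G A = G [set k | O k `<=` probe_set W O A].
  congr G; apply/seteqP; split=> k.
    by move=> Ak y Oy; right; exists k.
  by move=> /(_ _ (probes_mem _ _ _ _ tP k)) /probe_set_mem.
split=> [[_]|GA].
  by apply; left; exact: (probesW0 _ _ _ _ tP).
split=> //; apply: topologyU; first by case: Lt => -[].
  exact: (probesW _ _ _ _ tP).
exact: open_bigcup_in (probesO _ _ _ _ tP) (probesO0 _ _ _ _ tP).
Qed.

Lemma coarsen_le G H : coarsen t O G `<=` coarsen t O H -> G `<=` H.
Proof. by move=> GH A /coarsen_probe_set/GH/coarsen_probe_set. Qed.

(** A countable base [D] at 0 is pulled back to [nat] along [x]. *)
Lemma L0star_countably_generated G : Filter G ->
  L0star (coarsen t O G) -> countably_generated G.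
Proof.
rewrite L0starE => FG [_ [D [_ DE]]].
exists (fun m => [set k | D m (x k)]); split=> [m|A GA].
  (* Adding [W] makes [D m] a Euclidean neighborhood of 0 without catching any [x k]. *)
  have : nbhd_filter (coarsen t O G) 0 (D m `|` W).
    rewrite DE; split.
      have [[_ [_ te]] _] := Lt.
      exists W; split; first by apply: te; exact: (probesW _ _ _ _ tP).
      by split=> //; exact: (probesW0 _ _ _ _ tP).
    by exists m => y; left.
  move=> [U [[tU UG] [U0 UDW]]]; apply: filterS (UG U0) => k OU.
  have [//|] := UDW _ (OU _ (probes_mem _ _ _ _ tP k)).
  by move/(probes_notin _ _ _ _ tP).
have : nbhd_filter (coarsen t O G) 0 (probe_set W O A).
  exists (probe_set W O A); split; first exact/coarsen_probe_set.
  by split=> //; left; exact: (probesW0 _ _ _ _ tP).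
rewrite DE => -[_ [m Dm]]; exists m => k /Dm; exact: probe_set_mem.
Qed.

End Probes.

(** [within A \oo] is generated by the tails of [A], so joining each [C n] with each tail of the
    [O k], [k] in [A], gives a countable base. *)
Lemma L0star_coarsen t (O : nat -> set RR) (A : set nat) :
  L0star t -> (forall k, open (O k)) -> (forall k, ~ O k 0) -> L0 (coarsen t O (within A \oo)) ->
  L0star (coarsen t O (within A \oo)).
Proof.
rewrite !L0starE => -[Lt [C [[Cne Cbase] CE]]] oO O0 LtO; split=> //.
have [topt _] := Lt.1.
(* A number coding no pair stands for [(0, 0)], which only repeats a member of the base. *)
pose ij k := odflt (0, 0)%N (unpickle k : option (nat * nat)).
pose tail m := \bigcup_(k in A `&` [set k | (m <= k)%N]) O k.
pose D k := C (ij k).1 `|` tail (ij k).2.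
have ijK n m : ij (pickle (n, m)) = (n, m) by rewrite /ij pickleK.
exists D; split; [split=> [k|k l]|].
- by have [y Cy] := Cne (ij k).1; exists y; left.
- have [n CnI] := Cbase (ij k).1 (ij l).1.
  exists (pickle (n, maxn (ij k).2 (ij l).2)); rewrite /D ijK /= => y [/CnI[]|].
    by split; left.
  move=> [j [Aj /=]]; rewrite geq_max => /andP[kj lj] Oj.
  by split; right; exists j.
apply/seteqP; split=> [V [U [[tU UG] [U0 UV]]]|V [V0 [k DV]]].
  have te := Lt.1.2.2.
  have : nbhd_filter t 0 U by exists U; split=> //; split.
  rewrite CE => -[_ [n CU]]; split; first by exists U; split; first exact: te.
  have [m _ mP] := UG U0; exists (pickle (n, m)); rewrite /D ijK /= => y.
  by move=> [/CU/UV //|[j [Aj mj] Oj]]; apply: UV; exact: (mP j mj).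
have : nbhd_filter t 0 V.
  by rewrite CE; split=> //; exists (ij k).1 => y Cy; apply: DV; left.
move=> [U [tU [U0 UV]]]; exists (U `|` tail (ij k).2); split; last first.
  by split; [left|move=> y [/UV //|Ty]; apply: DV; right].
split.
  by apply: topologyU => //; exact: open_bigcup_in.
move=> _; exists (ij k).2 => // j /= kj Aj y Oy.
by right; exists j.
Qed.

(** The principal filter at 0 contains every Euclidean neighborhood of 0. *)
Lemma L0star_eta : L0 eta -> L0star eta.
Proof.
rewrite L0starE => Le; split=> //; exists (fun=> [set 0]); split.
  by split=> [_|_ _]; [exists 0|exists 0%N].
apply/seteqP; split=> [V [U [oU [U0 UV]]]|V [] //].
split; first by exists U; split.
by exists 0%N => _ ->; exact: UV.
Qed.

(** * Piecewise linear automorphisms of the line *)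

Record nodes (R : realType) (u : nat -> R) : Prop := Nodes {
  nodes0 : u 0%N = 0;
  nodesS : forall n, u n < u n.+1;
  nodes_unbounded : forall M, exists n, M < u n }.

Lemma nodes_mono (R : realType) (u : nat -> R) : nodes R u ->
  {homo u : m n / (m <= n)%N >-> m <= n}.
Proof.
move=> uP; apply: homo_leq => // [x y z|n]; first exact: le_trans.
exact/ltW/nodesS.
Qed.

Lemma nodes_floor (R : realType) (u : nat -> R) (x : R) : nodes R u -> 0 <= x ->
  exists n, u n <= x < u n.+1.
Proof.
move=> uP x0; have [n xn mn] := ex_minnP (nodes_unbounded _ _ uP x).
case: n xn mn => [|n] xn mn; first by move: xn; rewrite (nodes0 _ _ uP) ltNge x0.
by exists n; rewrite xn andbT leNgt; apply/negP => /mn; rewrite ltnn.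
Qed.

Lemma nodes_floor_uniq (R : realType) (u : nat -> R) (x y : R) m n : nodes R u ->
  u m <= x < u m.+1 -> u n <= y < u n.+1 -> x <= y -> (m <= n)%N.
Proof.
move=> uP /andP[ux _] /andP[_ yu] xy; rewrite leqNgt; apply/negP => nm.
have := nodes_mono _ _ uP _ _ nm.
by rewrite leNgt (le_lt_trans ux (le_lt_trans xy yu)).
Qed.

Definition affine_piece (R : realType) (u v : nat -> R) (n : nat) (x : R) :=
  v n + (x - u n) * ((v n.+1 - v n) / (u n.+1 - u n)).

(** For [u] and [v] satisfying [nodes], each piece maps onto the piece of the same index; the
    default of [xget] is then never reached. *)
Definition piecewise (R : realType) (u v : nat -> R) (x : R) : R :=
  if x < 0 then x
  else affine_piece R u v (xget 0%N [set n | u n <= x < u n.+1]) x.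

Section Piecewise.
Variables (R : realType) (u v : nat -> R).
Hypotheses (uP : nodes R u) (vP : nodes R v).

Lemma piecewiseE n x : u n <= x < u n.+1 -> piecewise R u v x = affine_piece R u v n x.
Proof.
move=> nx; have x0 : 0 <= x.
  case/andP: nx => + _; apply: le_trans; rewrite -(nodes0 _ _ uP).
  exact: nodes_mono.
rewrite /piecewise ltNge x0 /=; congr affine_piece.
have : [set n | u n <= x < u n.+1] n by [].
case: xgetP => [m _ mx _|/(_ n) //].
by apply/eqP; rewrite eqn_leq !(@nodes_floor_uniq R u x x).
Qed.

Lemma slope_gt0 n : 0 < (v n.+1 - v n) / (u n.+1 - u n).
Proof. by rewrite divr_gt0 // subr_gt0 nodesS. Qed.

Lemma piecewise_bounds n x : u n <= x < u n.+1 -> v n <= piecewise R u v x < v n.+1.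
Proof.
move=> /[dup] /andP[ux xu] /piecewiseE ->; rewrite /affine_piece lerDl.
rewrite mulr_ge0 ?subr_ge0 // ?(ltW (slope_gt0 n)) //= -ltrBrDl.
rewrite mulrA ltr_pdivrMr ?subr_gt0 ?nodesS // mulrC ltr_pM2l ?ltrB2//.
  by rewrite ltrD2r.
by rewrite subr_gt0 nodesS.
Qed.

Lemma piecewise_node n : piecewise R u v (u n) = v n.
Proof.
rewrite (@piecewiseE n) ?lexx ?nodesS //.
by rewrite /affine_piece subrr mul0r addr0.
Qed.

Lemma piecewise_lt x y : x < y -> piecewise R u v x < piecewise R u v y.
Proof.
move=> xy; have [y0|y0] := ltP y 0.
  by rewrite /piecewise y0 (lt_trans xy y0).
have [n ny] := nodes_floor R u y uP y0; have /andP[ny' _] := piecewise_bounds n y ny.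
have [x0|x0] := ltP x 0.
  rewrite {1}/piecewise x0 (lt_le_trans x0) // (le_trans _ ny') //.
  by rewrite -(nodes0 _ _ vP) nodes_mono.
have [m mx] := nodes_floor R u x uP x0; have /andP[_ mx'] := piecewise_bounds m x mx.
have := nodes_floor_uniq R u x y m n uP mx ny (ltW xy).
rewrite leq_eqVlt => /orP[/eqP mn|mn].
  rewrite mn in mx; rewrite !(@piecewiseE n) // ltrD2l ltr_pM2r ?slope_gt0 //.
  by rewrite ltrD2r.
exact: lt_le_trans mx' (le_trans (nodes_mono _ _ vP _ _ mn) ny').
Qed.

End Piecewise.

Lemma piecewiseK (R : realType) (u v : nat -> R) : nodes R u -> nodes R v ->
  cancel (piecewise R u v) (piecewise R v u).
Proof.
move=> uP vP x; have [x0|x0] := ltP x 0.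
  by rewrite {2}/piecewise x0 /piecewise x0.
have [n nx] := nodes_floor R u x uP x0.
rewrite (@piecewiseE _ v u vP n) ?piecewise_bounds // (@piecewiseE _ u v uP n) //.
have un : u n.+1 - u n != 0 by rewrite subr_eq0 gt_eqF // nodesS.
have vn : v n.+1 - v n != 0 by rewrite subr_eq0 gt_eqF // nodesS.
by rewrite /affine_piece; field; rewrite un vn.
Qed.

(** The inverse [g] turns the bounds [f x - e] and [f x + e] into an open interval around [x]. *)
Lemma increasing_cancel_continuous (R : realType) (f g : R -> R) :
  cancel f g -> cancel g f -> {homo f : x y / x < y} -> {homo g : x y / x < y} ->
  continuous f.
Proof.
move=> fK gK fi gi x; apply/cvgrPdist_lt => e e0.
have xl : g (f x - e) < x by rewrite -{2}[x]fK gi // ltrBlDr ltrDl.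
have xr : x < g (f x + e) by rewrite -{1}[x]fK gi // ltrDl.
near=> y.
have : g (f x - e) < y by near: y; apply: (open_gt).
move=> /fi; rewrite gK => h1.
have : y < g (f x + e) by near: y; exact: open_lt.
move=> /fi; rewrite gK => h2.
by rewrite ltr_distlC ltrBlDr h2 -ltrBlDr h1.
Unshelve. all: by end_near. Qed.

Lemma increasing_cancel_open (f g : RR -> RR) (U : set RR) :
  cancel f g -> cancel g f -> {homo f : x y / x < y} -> {homo g : x y / x < y} ->
  open U -> open (f @^-1` U).
Proof.
move=> fK gK fi gi; apply: open_comp => x _.
exact: (@increasing_cancel_continuous RR f g).
Qed.

(** * Homeomorphisms between tail topologies *)

Record interlaced (R : realType) (l r : nat -> R) : Prop := Interlaced {
  interlaced_gt0 : 0 < l 0%N;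
  interlaced_lt : forall k, l k < r k;
  interlacedS : forall k, r k < l k.+1;
  interlaced_unbounded : forall k, k%:R <= l k }.

(** The sequence 0, [l 0], [r 0], [l 1], [r 1], and so on. *)
Definition interlace (R : realType) (l r : nat -> R) (n : nat) : R :=
  if n is m.+1 then (if odd m then r m./2 else l m./2) else 0.

Lemma nodes_interlace (R : realType) (l r : nat -> R) :
  interlaced R l r -> nodes R (interlace R l r).
Proof.
case=> l0 lr rl lk; split=> // [[|n]|M] //=.
  have [on|en] := boolP (odd n); rewrite uphalf_half ?on ?(negbTE en) /=.
    by rewrite add1n.
  by rewrite add0n.
exists (Num.bound `|M|).*2.+1; rewrite /= odd_double /= doubleK.
apply: le_lt_trans (ler_norm M) _; apply: lt_le_trans (lk _).
by rewrite archi_boundP.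
Qed.

(** The sign [s], 1 or -1 in use, selects the half-line on which the intervals escape. *)
Definition tail_interval (s : RR) (l r : nat -> RR) (k : nat) : set RR :=
  [set x | l k < s * x < r k].

Lemma tail_interval_open s l r k : open (tail_interval s l r k).
Proof.
have -> : tail_interval s l r k = ( *%R s) @^-1` [set x | l k < x] `&`
    ( *%R s) @^-1` [set x | x < r k].
  by apply/seteqP; split=> x /andP.
by apply: openI; (apply: open_comp; first by move=> x _; exact: mulrl_continuous);
  [exact: open_gt|exact: open_lt].
Qed.

Lemma tail_interval0 s l r k : interlaced RR l r -> ~ tail_interval s l r k 0.
Proof.
move=> lrP; rewrite /tail_interval /= mulr0 => /andP[+ _].
by rewrite ltNge (le_trans _ (interlaced_unbounded _ _ _ lrP k)).
Qed.

(** The map fixes 0 and, up to the reflection [s], carries the [k]-th interval of one sequence to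
    that of the other. *)
Lemma coarsen_tail_preimage (s : RR) (l r l' r' : nat -> RR) (U : set RR) :
  s * s = 1 -> interlaced RR l r -> interlaced RR l' r' ->
  coarsen eta (tail_interval s l' r') \oo U ->
  coarsen eta (tail_interval s l r) \oo
    ((fun x => s * piecewise RR (interlace RR l r) (interlace RR l' r') (s * x)) @^-1` U).
Proof.
move=> ss lrP lrP' [oU U0].
have [uP vP] := (nodes_interlace _ _ _ lrP, nodes_interlace _ _ _ lrP').
split.
  apply: (@open_comp _ _ ( *%R s) (piecewise RR _ _ @^-1` (( *%R s) @^-1` U))).
    by move=> x _; exact: mulrl_continuous.
  apply: (@increasing_cancel_open _
    (piecewise RR (interlace RR l' r') (interlace RR l r))).
  - exact: piecewiseK.
  - exact: piecewiseK.
  - by move=> x y; exact: piecewise_lt.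
  - by move=> x y; exact: piecewise_lt.
  - by apply: open_comp => // x _; exact: mulrl_continuous.
rewrite /preimage /= mulr0.
have := piecewise_node _ _ (interlace RR l' r') uP 0%N; rewrite /= => ->; rewrite mulr0.
move=> /U0; apply: filterS => k kU x /andP[lx xr] /=.
apply: kU; rewrite /tail_interval /= mulrA ss mul1r.
have pl := piecewise_node _ _ (interlace RR l' r') uP k.*2.+1.
have pr := piecewise_node _ _ (interlace RR l' r') uP k.*2.+2.
rewrite /= odd_double /= doubleK in pl.
rewrite /= odd_double /= uphalf_double in pr.
by rewrite -pl -pr !piecewise_lt.
Qed.

Lemma homeomorphic_tails (s : RR) (l r l' r' : nat -> RR) :
  s * s = 1 -> interlaced RR l r -> interlaced RR l' r' ->
  homeomorphic (coarsen eta (tail_interval s l r) \oo)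
               (coarsen eta (tail_interval s l' r') \oo).
Proof.
move=> ss lrP lrP'.
have [uP vP] := (nodes_interlace _ _ _ lrP, nodes_interlace _ _ _ lrP').
exists (fun x => s * piecewise RR (interlace RR l r) (interlace RR l' r') (s * x)).
exists (fun x => s * piecewise RR (interlace RR l' r') (interlace RR l r) (s * x)).
split=> [x|]; first by rewrite mulrA ss mul1r piecewiseK // mulrA ss mul1r.
split=> [x|]; first by rewrite mulrA ss mul1r piecewiseK // mulrA ss mul1r.
by split=> U; exact: coarsen_tail_preimage.
Qed.

(* A cluster point of the traces on the complement of [W] of the [t]-neighborhoods
   of [0] could only be [0], which is interior to [W]; so these traces leave every
   bounded set. *)
Lemma trace_unbounded t (W U : set RR) (M : RR) : L0 t -> open W -> W 0 -> ~ t W ->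
  t U -> U 0 -> exists x, [/\ U x, ~ W x & M < `|x|].
Proof.
move=> Lt oW W0 tW tU U0; apply: contrapT => noX.
have [[topt [haus te]] _] := Lt; have [t0 [tT [tbig tI]]] := topt.
pose F : set_system RR := [set S | exists V, [/\ t V, V 0 & V `\` W `<=` S]].
(* An empty trace would make [W] a [t]-neighborhood of 0, hence a member of [t]. *)
have FF : ProperFilter F.
  split.
    move=> [V [tV V0 VW]]; apply: tW; apply: L0_openP => // _.
    exists V; split=> //; split=> // x Vx; apply: contrapT => Wx.
    exact: (VW x).
  split; first by exists setT.
    move=> P Q [V [tV V0 VP]] [V' [tV' V0' VQ]]; exists (V `&` V'); split=> //.
      exact: tI.
    by move=> x [[Vx V'x] Wx]; split; [apply: VP|apply: VQ].
  by move=> P Q PQ [V [tV V0 VP]]; exists V; split=> // x /VP/PQ.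
have FK : F `[- M, M]%classic.
  exists U; split=> // x [Ux Wx]; rewrite /= in_itv /= -ler_norml leNgt.
  by apply/negP => Mx; apply: noX; exists x.
have [p [_ pF]] := @segment_compact RR _ _ F FF FK.
have FW : F (~` W) by exists U; split=> // x [].
have [p0|/eqP p0] := eqVneq p 0.
  by rewrite p0 in pF; have [x []] := pF _ _ FW (open_nbhs_nbhs (conj oW W0)).
have [V [V' [tV [tV' [Vp [V'0 VV']]]]]] := haus _ _ p0.
have FV : F V' by exists V'; split=> // x [].
have [x [V'x Vx]] := pF _ V FV (open_nbhs_nbhs (conj (te _ tV) Vp)).
by have : (V `&` V') x by []; rewrite VV'.
Qed.

(** * Intervals escaping to infinity *)

(** [B i] together with the unit ball is a [t]-neighborhood of 0; finitely many of these are
    intersected. *)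
Lemma far_part_in_base t (B : nat -> set RR) n : L0 t ->
  nbhd_filter t 0 = nbhd_filter eta 0 `&` gen_filter B ->
  exists U : set RR, [/\ t U, U 0 &
    forall i x, (i <= n)%N -> U x -> 1 < `|x| -> B i x].
Proof.
move=> Lt tB; have [[[t0 [tT [tbig tI]]] _] _] := Lt.
have one i : exists U : set RR, [/\ t U, U 0 & forall x, U x -> 1 < `|x| -> B i x].
  have : nbhd_filter t 0 (B i `|` ball (0 : RR) 1).
    rewrite tB; split; last by exists i => x; left.
    exists (ball (0 : RR) 1); split; first exact: ball_open.
    by split; [exact: ballxx|move=> x; right].
  move=> [U [tU [U0 UB]]]; exists U; split=> // x /UB[//|].
  by rewrite /ball /= sub0r normrN => /lt_gtF ->.
elim: n => [|n [U [tU U0 UB]]].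
  have [U [tU U0 UB]] := one 0%N; exists U; split=> // i x.
  by rewrite leqn0 => /eqP->; exact: UB.
have [V [tV V0 VB]] := one n.+1; exists (U `&` V); split=> //; first exact: tI.
move=> i x; rewrite leq_eqVlt => /orP[/eqP->|ni] [Ux Vx] x1; first exact: VB.
exact: UB.
Qed.

Lemma escape_interval t (W : set RR) (B : nat -> set RR) : L0 t ->
  nbhd_filter t 0 = nbhd_filter eta 0 `&` gen_filter B ->
  open W -> W 0 -> ~ t W ->
  exists2 s : RR, s * s = 1 & forall n M, exists a y b,
    [/\ M < a, a < y, y < b, ~ W (s * y) &
        forall i x, (i <= n)%N -> a < s * x < b -> B i x].
Proof.
move=> Lt tB oW W0 tW.
pose P (s : RR) n (M : RR) := exists a y b : RR, [/\ M < a, a < y, y < b, ~ W (s * y) &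
        forall i (x : RR), (i <= n)%N -> a < s * x < b -> B i x].
have PS s n n' M M' : (n' <= n)%N -> M' <= M -> P s n M -> P s n' M'.
  move=> nn MM [a [y [b [Ma ay yb Wy aB]]]]; exists a, y, b; split=> //.
    exact: le_lt_trans Ma.
  by move=> i x /leq_trans => /(_ _ nn); exact: aB.
have P1 n (M : RR) : P 1 n M \/ P (-1) n M.
  have [U [tU U0 UB]] := far_part_in_base t B n Lt tB.
  (* The margin 2 keeps an interval of radius at most 1 around [|x|] beyond [M] and its points
     outside the unit ball. *)
  clear tB; have [x [Ux Wx Mx]] := trace_unbounded t W U (`|M| + 2) Lt oW W0 tW tU U0.
  have [[_ [_ te]] _] := Lt.
  have /nbhs_ballP[e /= e0 eU] : nbhs x U by apply: open_nbhs_nbhs; split=> //; exact: te.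
  pose d : RR := Num.min e 1.
  have d0 : 0 < d by rewrite lt_min e0 ltr01.
  have d1 : d <= 1 by rewrite ge_min lexx orbT.
  have MM := ler_norm M; have M0 := normr_ge0 M.
  suff sP (s : RR) : s * s = 1 -> s * x = `|x| -> P s n M.
    have [x0|x0] := leP 0 x.
      by left; apply: sP; rewrite ?mul1r ?ger0_norm.
    by right; apply: sP; rewrite ?mulrNN ?mul1r // mulN1r ltr0_norm.
  move=> ss sx; exists (`|x| - d), `|x|, (`|x| + d); split; try lra.
    by rewrite -sx mulrA ss mul1r.
  move=> i z ni; rewrite -sx => /andP[h1 h2].
  have s1 : `|s| = 1.
    by apply/eqP; rewrite -sqrp_eq1 ?normr_ge0 // -normrX expr2 ss normr1.
  have zx : `|x - z| < d.
    by rewrite -[`|_|]mul1r -s1 -normrM mulrBr ltr_norml; apply/andP; split; lra.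
  apply: UB ni _ _; first by apply: eU; rewrite /ball /= (lt_le_trans zx) // ge_min lexx.
  have := ler_normD (x - z) z; rewrite subrK; lra.
(* If each sign failed at some pair, both would fail at the maxima of the pairs, against [P1]. *)
apply: contrapT => noS.
have [n1 [M1 nP1]] : exists n M, ~ P 1 n M.
  apply: contrapT => H; apply: noS; exists 1; first by rewrite mul1r.
  by move=> n M; apply: contrapT => H'; apply: H; exists n, M.
have [n2 [M2 nP2]] : exists n M, ~ P (-1) n M.
  apply: contrapT => H; apply: noS; exists (-1); first by rewrite mulrNN mul1r.
  by move=> n M; apply: contrapT => H'; apply: H; exists n, M.
have [] := P1 (maxn n1 n2) (Num.max M1 M2).
- by apply/(contra_not _ nP1)/PS; rewrite ?leq_maxl// le_max lexx.
- by apply/(contra_not _ nP2)/PS; rewrite ?leq_maxr// le_max lexx orbT.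
Qed.

Lemma escape_sequence t (W : set RR) (B : nat -> set RR) : L0 t ->
  nbhd_filter t 0 = nbhd_filter eta 0 `&` gen_filter B ->
  open W -> W 0 -> ~ t W ->
  exists (s : RR) (a y b : nat -> RR),
    [/\ s * s = 1, interlaced RR a b, forall k, a k < y k < b k,
        forall k, ~ W (s * y k) &
        forall i k, (i <= k)%N -> tail_interval s a b k `<=` B i].
Proof.
move=> Lt tB oW W0 tW; have [s ss sP] := escape_interval t W B Lt tB oW W0 tW.
pose good n M (c : RR * RR * RR) :=
  [/\ M < c.1.1, c.1.1 < c.1.2, c.1.2 < c.2, ~ W (s * c.1.2) &
      forall i x, (i <= n)%N -> c.1.1 < s * x < c.2 -> B i x].
have /choice[h hP] : forall nM : nat * RR, exists c, good nM.1 nM.2 c.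
  by move=> [n M]; have [a [y [b H]]] := sP n M; exists (a, y, b).
(* Starting beyond the previous right end keeps the intervals in order; starting beyond [k] sends
   them to infinity. *)
pose z := fix z k := if k is k'.+1
  then h (k, Num.max (z k').2 k%:R) else h (0%N, 0).
have zP k : exists2 M, k%:R <= M & good k M (z k).
  case: k => [|k] /=; first by exists 0 => //; exact: (hP (0%N, 0)).
  by exists (Num.max (z k).2 k.+1%:R); [rewrite le_max lexx orbT|exact: hP (_, _)].
exists s, (fun k => (z k).1.1), (fun k => (z k).1.2), (fun k => (z k).2).
split=> //.
- split=> [|k|k|k].
  + by have [M M0 [Ma _ _ _ _]] := zP 0%N; exact: le_lt_trans Ma.
  + by have [M _ [_ ay yb _ _]] := zP k; exact: lt_trans yb.
  + have [/= Ma _ _ _ _] := hP (k.+1, Num.max (z k).2 k.+1%:R).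
    by apply: le_lt_trans Ma; rewrite le_max lexx.
  + by have [M M0 [Ma _ _ _ _]] := zP k; exact/ltW/(le_lt_trans M0).
- by move=> k; have [M _ [_ -> -> _ _]] := zP k.
- by move=> k; have [M _ [_ _ _ ? _]] := zP k.
- by move=> i k ik x; have [M _ [_ _ _ _ H]] := zP k; exact: H.
Qed.

(** * Chains and antichains between two topologies *)

Lemma interlaced_uniq (R : realType) (l r : nat -> R) (x : R) j k :
  interlaced R l r -> l j < x < r j -> l k < x < r k -> j = k.
Proof.
move=> [_ lr rl _].
have mono : {homo l : m n / (m <= n)%N >-> m <= n}.
  apply: homo_leq => // [u v w|n]; first exact: le_trans.
  exact: ltW (lt_trans (lr n) (rl n)).
wlog jk : j k / (j <= k)%N.
  by move=> H; case: (leqP j k) => [/H //|/ltnW kj] ? ?; apply/esym/H.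
move=> /andP[_ xj] /andP[kx _]; apply/eqP; rewrite eqn_leq jk leqNgt /=.
apply/negP => /mono; rewrite leNgt => /negP; apply.
exact: lt_trans kx (lt_trans xj (rl j)).
Qed.

Lemma interlaced_raise (R : realType) (a y b l : nat -> R) : interlaced R a b ->
  (forall k, a k < y k < b k) -> (forall k, l k = a k \/ l k = y k) ->
  interlaced R l b.
Proof.
move=> [a0 ab ba ak] ayb lay.
have al k : a k <= l k by have /andP[/ltW ay _] := ayb k; case: (lay k) => ->.
split=> [|k|k|k].
- exact: lt_le_trans a0 (al 0%N).
- by have /andP[_ yb] := ayb k; case: (lay k) => ->.
- exact: lt_le_trans (ba k) (al k.+1).
- exact: le_trans (ak k) (al k).
Qed.

(** Two successive coarsenings merge into one along the cofinite filter, the form that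
    [homeomorphic_tails] handles. *)
Lemma coarsen_coarsen_within t (s : RR) (a y b : nat -> RR) (A : set nat) :
  (forall k, a k < y k) ->
  coarsen (coarsen t (tail_interval s y b) \oo) (tail_interval s a b) (within A \oo) =
  coarsen t (tail_interval s (fun k => if `[< A k >] then a k else y k) b) \oo.
Proof.
move=> ay; apply/seteqP; split=> [U [[tU UJ] UI]|U [tU UO]].
  split=> // U0; apply: filterS2 (UJ U0) (UI U0) => k JU IU x.
  by rewrite /tail_interval /=; case: asboolP => [/IU|_]; [exact|exact: JU].
split; first split=> // U0; last move=> U0.
  apply: filterS (UO U0) => k OU x /andP[yx xb]; apply: OU.
  by rewrite /tail_interval /= xb andbT; case: asboolP => // _; exact: lt_trans yx.
apply: filterS (UO U0) => k OU Ak x Ix; apply: OU.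
by rewrite /tail_interval /= asboolT.
Qed.

Lemma within_setT (T : Type) (F : set_system T) : Filter F -> within setT F = F.
Proof.
move=> FF; apply/seteqP; split=> P; rewrite /within /= => FP.
  by apply: filterS FP => x /(_ Logic.I).
by apply: filterS FP.
Qed.

(** [A] itself belongs to its filter. *)
Lemma within_eventually_le (A B : set nat) : within A \oo `<=` within B \oo ->
  exists n, forall k, (n <= k)%N -> B k -> A k.
Proof.
move=> AB; have [n _ nP] : within B \oo A by apply: AB; exists 0%N.
by exists n => k nk; exact: nP.
Qed.

Lemma within_anti (A B : set nat) : A `<=` B -> within B \oo `<=` within A \oo.
Proof.
by move=> AB P; rewrite /within /= => BP; apply: filterS BP => k BP /AB/BP.
Qed.

Lemma eventually_within (A : set nat) : \oo `<=` within A \oo.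
Proof. by move=> P oP; apply: filterS oP => k Pk _. Qed.

Theorem theorem8 (t1 t2 : set (set RR)) :
  L0star t1 -> L0 t2 -> t1 `<=` t2 -> t1 <> t2 ->
  exists (Rf Sf Tf : set (set (set RR))),
    (Rf `<=` L0 /\ is_chain Rf /\ (Rf #= [set: RR])%card) /\
    (Sf `<=` L0 /\ pairwise_incomparable Sf /\ (Sf #= [set: RR])%card) /\
    (Tf `<=` (L0 `\` L0star) /\ pairwise_incomparable Tf /\
       (Tf #= [set: set RR])%card) /\
    (forall t, (Rf `|` Sf `|` Tf) t -> t1 `<=` t /\ t `<=` t2) /\
    (L0star t2 -> Rf `<=` L0star /\ Sf `<=` L0star) /\
        (t2 = eta -> Rf `<=` L0star /\ Sf `<=` L0star /\
           (forall t t', (Rf `|` Sf) t -> (Rf `|` Sf) t' -> homeomorphic t t')).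
Proof.
rewrite L0starE => -[Lt1 [B [_ t1B]]] Lt2 t12 t12N.
have [[top2 [_ t2e]] _] := Lt2.
have [W t2W t1W] : exists2 W, t2 W & ~ t1 W.
  apply: contrapT => H; apply: t12N; apply/seteqP; split=> // W t2W.
  by apply: contrapT => t1W; apply: H; exists W.
have oW : open W by exact: t2e.
have W0 : W 0 by apply: contrapT => W0; apply: t1W; exact: L0_openP.
have [s [a [y [b [ss ab ayb Wy IB]]]]] := escape_sequence t1 W B Lt1 t1B oW W0 t1W.
have ay k : a k < y k by have /andP[] := ayb k.
have yb : interlaced RR y b by apply: interlaced_raise ab ayb _ => k; right.
pose I := tail_interval s a b; pose J := tail_interval s y b.
have JI k : J k `<=` I k.
  by move=> x /andP[yx xb]; rewrite /I /tail_interval /= xb (lt_trans (ay k)).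
have [oI oJ] : (forall k, open (I k)) /\ (forall k, open (J k)).
  by split=> k; exact: tail_interval_open.
have [I0 J0] : (forall k, ~ I k 0) /\ (forall k, ~ J k 0).
  by split=> k; exact: tail_interval0.
(* Such a [U] contains some [B n], hence every [I k] with [k >= n]. *)
have t1I U : t1 U -> U 0 -> \oo [set k | I k `<=` U].
  move=> t1U U0; have : nbhd_filter t1 0 U by exists U; split=> //; split.
  rewrite t1B => -[_ [n BU]]; exists n => // k nk x Ix.
  by apply: BU; exact: IB Ix.
(* With the [J k] built in, every index keeps an interval whatever [A] is, so the topologies can be
   matched index by index. *)
pose t3 := coarsen t2 J \oo.
have t13 : t1 `<=` t3.
  move=> U t1U; split; first exact: t12.
  move=> /(t1I _ t1U); apply: filterS => k IU; exact: subset_trans IU.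
have top3 : is_topology t3 by exact: coarsen_topology.
have Lt3 : L0 t3.
  by apply: L0_between Lt1 top3 t13 _; apply: subset_trans t2e; exact: coarsen_sub.
(* Up to sign, [y k] is the excluded left end of [J k], so no right half contains the probe
   point. *)
have x_in k j : (I j (s * y k) -> j = k) /\ ~ J j (s * y k).
  rewrite /I /J /tail_interval /= mulrA ss mul1r.
  have uq : a j < y k < b j -> j = k.
    by move=> jk; exact: interlaced_uniq ab jk (ayb k).
  split=> // /andP[jk kb]; have jE : j = k by apply: uq; rewrite (lt_trans (ay j)).
  by rewrite jE ltxx in jk.
have pr : probes t3 (probe_set W J setT) I (fun k => s * y k).
  split=> //.
  - split; first by apply: topologyU => //; exact: open_bigcup_in.
    by move=> _; exists 0%N => // k _ x Jx; right; exists k.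
  - by left.
  - by move=> k; rewrite /I /tail_interval /= mulrA ss mul1r ayb.
  - by move=> k [/Wy //|[j _ /(proj2 (x_in k j))]].
  - by move=> j k; exact: (proj1 (x_in k j)).
pose T G := coarsen t3 I G.
have T_le G H : T G `<=` T H -> G `<=` H by exact: coarsen_le _ _ _ _ Lt3 pr G H.
have T_between G : Filter G -> \oo `<=` G -> L0 (T G) /\ t1 `<=` T G /\ T G `<=` t2.
  move=> FG ooG; have t1T : t1 `<=` T G.
    by move=> U t1U; split; [exact: t13|move=> /(t1I _ t1U)/ooG].
  have Tt2 : T G `<=` t2 by move=> U [[]].
  split=> //; apply: L0_between Lt1 _ t1T (subset_trans Tt2 t2e).
  exact: coarsen_topology.
have T_star A : L0star t2 -> L0star (T (within A \oo)).
  move=> st2; have [LT _] := T_between (within A \oo) _ (eventually_within A).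
  apply: L0star_coarsen => //.
  (* Written as [within setT \oo], the cofinite filter falls under the same lemma. *)
  by rewrite /t3 -[\oo]within_setT; apply: L0star_coarsen; rewrite ?within_setT.
have T_homeo A A' : t2 = eta -> homeomorphic (T (within A \oo)) (T (within A' \oo)).
  move=> t2E; rewrite /T /t3 t2E !coarsen_coarsen_within //.
  by apply: homeomorphic_tails => //; apply: interlaced_raise ab ayb _ => k;
    case: ifP; by [left|right].
have [D [Dmono Dlt]] := chain_family; have [A Aind] := independent_family.
pose Tc r := T (within (D r) \oo); pose Ta r := T (within (A r) \oo).
pose Tl S := T (literal_filter A S).
have Tc_anti r r' : r <= r' -> Tc r' `<=` Tc r.
  by move=> /Dmono DD; apply: coarsenS; exact: within_anti.
have Tc_lt r r' : r < r' -> ~ (Tc r `<=` Tc r').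
  move=> rr /T_le/within_eventually_le[n nP].
  by have [k [nk D'k Dk]] := Dlt _ _ n rr; apply: Dk; exact: nP.
have Tc_inj r r' : Tc r = Tc r' -> r = r'.
  move=> TE; apply/eqP; rewrite eq_le !leNgt.
  by apply/andP; split; apply/negP => /Tc_lt; rewrite TE; apply.
(* Independence puts arbitrarily large [k] in [A r'] but not in [A r] when [r] and [r'] differ. *)
have Ta_le r r' : Ta r `<=` Ta r' -> r = r'.
  move=> /T_le/within_eventually_le[n nP]; apply: contrapT => /eqP rr.
  have [|k [nk Ar' Ar]] := Aind [:: r'] [:: r] _ n.
    by move=> x; rewrite !inE => /eqP ->; rewrite eq_sym.
  by apply: (Ar r (mem_head _ _)); apply: nP => //; apply: Ar'; exact: mem_head.
have Tl_le S S' : Tl S `<=` Tl S' -> S = S'.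
  by move=> /T_le; exact: literal_filter_inj.
exists (range Tc), (range Ta), (range Tl); split; [|split; [|split; [|split; [|split]]]].
- split; first by move=> _ [r _ <-]; exact: (T_between _ _ (eventually_within _)).1.
  split; last by apply: inj_card_eq => r r' _ _; exact: Tc_inj.
  move=> _ _ [r _ <-] [r' _ <-].
  by have [/Tc_anti|/ltW/Tc_anti] := leP r r'; [right|left].
- split; first by move=> _ [r _ <-]; exact: (T_between _ _ (eventually_within _)).1.
  split; last by apply: inj_card_eq => r r' _ _ TE; apply: Ta_le; rewrite TE.
  by move=> _ _ [r _ <-] [r' _ <-] N; split=> /Ta_le E; apply: N; rewrite E.
- have FL := literal_filter_filter A.
  split.
    move=> _ [S _ <-]; split.
      exact: (T_between _ _ (eventually_literal_filter A S)).1.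
    move=> /(L0star_countably_generated _ _ _ _ Lt3 pr _ (FL S)).
    exact: literal_filter_not_countably_generated.
  split; last by apply: inj_card_eq => S S' _ _ TE; apply: Tl_le; rewrite TE.
  by move=> _ _ [S _ <-] [S' _ <-] N; split=> /Tl_le E; apply: N; rewrite E.
- move=> t [[|] [r _ <-]|[S _ <-]].
  + exact: (T_between _ _ (eventually_within _)).2.
  + exact: (T_between _ _ (eventually_within _)).2.
  + have FL := literal_filter_filter A S.
    exact: (T_between _ _ (eventually_literal_filter A S)).2.
- by move=> st2; split=> _ [r _ <-]; exact: T_star.
- move=> t2E; have st2 : L0star t2 by rewrite t2E in Lt2 *; exact: L0star_eta.
  split; first by move=> _ [r _ <-]; exact: T_star.
  split; first by move=> _ [r _ <-]; exact: T_star.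
  by move=> t t' [[r _ <-]|[r _ <-]] [[r' _ <-]|[r' _ <-]]; exact: T_homeo.
Qed.
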